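(* Let $l\geq 4$ be an integer and let $\Sigma=\{L_1,\dots,L_n\}$ be a finite family of mutually skew lines in $\mathbb{R}^l$ such that the three dimensional affine hull of every two lines in $\Sigma$ contains at least one more line of $\Sigma$. Let $H_1,\dots,H_m$ be the distinct three dimensional affine hulls of pairs of distinct lines of $\Sigma$, and suppose $m\geq 2$. If there is a point $O\in\bigcap_{i=1}^m H_i$, then there exists a line $L\subset\mathbb{R}^l$ passing through $O$, different from each $L_i$, such that $L_i$ and $L$ are coplanar for each $1\leq i\leq n$.
   Context: Two lines in $\mathbb{R}^l$ are skew if they are neither intersecting nor parallel, equivalently their affine hull (smallest affine subspace containing both) is three dimensional. Mutually skew means pairwise skew. Two lines are coplanar if they lie in a common two dimensional affine plane. *)

(* Defs.v *)
From mathcomp Require Export all_boot all_order all_algebra.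
From mathcomp Require Export boolp classical_sets reals.

Set Implicit Arguments.
Unset Strict Implicit.
Unset Printing Implicit Defensive.

Import GRing.Theory.
Local Open Scope ring_scope.
Local Open Scope classical_set_scope.

Section AffineGeometry.
Variables (R : realType) (l : nat).
Implicit Types (p : 'rV[R]_l) (V : {vspace 'rV[R]_l}).
Implicit Types (A B S : set 'rV[R]_l).

(* The translate p + V. *)
Definition flat p V : set 'rV[R]_l := [set x | x - p \in V].

Definition affine_subspace A : Prop := exists p V, A = flat p V.

Definition affine_subspace_dim (k : nat) A : Prop :=
  exists p V, \dim V = k /\ A = flat p V.

Definition is_line A : Prop := affine_subspace_dim 1 A.

Definition is_plane A : Prop := affine_subspace_dim 2 A.

(* Affine subspaces are nonempty here, so this is the usual affine hull only
   for nonempty S. *)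
Definition affine_hull S : set 'rV[R]_l := smallest affine_subspace S.

(* Same direction space; in particular a line is parallel to itself. *)
Definition parallel A B : Prop :=
  exists p q V, A = flat p V /\ B = flat q V.

Definition skew A B : Prop := ~ (A `&` B !=set0) /\ ~ parallel A B.

Definition coplanar A B : Prop :=
  exists P, [/\ is_plane P, A `<=` P & B `<=` P].

(* The affine hulls of pairs of distinct members of a family; distinctness of
   indices is distinctness of members when the family is mutually skew. *)
Definition pair_hulls (n : nat) (L : 'I_n -> set 'rV[R]_l) :
    set (set 'rV[R]_l) :=
  [set H | exists i j, i != j /\ H = affine_hull (L i `|` L j)].

End AffineGeometry.

(* Main.v *)
Require Import Defs.

(** Translate so that [O] is the origin. A line [L_i] avoiding [O] spans with
    [O] a linear plane [P_i], and the hull of [L_i] and [L_j] is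
    [W_ij = P_i + P_j], of dimension 3, so that [P_i] and [P_j] share a line.
    Planes that pairwise share a line either all share one line, which is then
    the required one, or all lie in a single 3-space, which [m >= 2] excludes.
    At most one [L_k] passes through [O]; as [W_ik] contains a third line [L_j],
    it equals [W_ij], so [L_k] produces no further hull. *)

Import GRing.Theory.

Local Open Scope ring_scope.
Local Open Scope classical_set_scope.

(** * Linear algebra of planes that pairwise share a line *)

Section CommonLine.
Set Implicit Arguments.
Unset Strict Implicit.
Variables (K : fieldType) (vT : vectType K).
Implicit Types (U : {vspace vT}) (x y : vT).

Lemma memv_line_dim1 U x y :
  (\dim U <= 1)%N -> x != 0 -> x \in U -> y \in U -> y \in <[x]>%VS.
Proof.
move=> dU nx xU yU; suff -> : <[x]>%VS = U by [].
by apply/eqP; rewrite eqEdim -memvE xU dim_vline nx.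
Qed.

Lemma memv_line_trans U x y : x \in <[y]>%VS -> y \in U -> x \in U.
Proof. by rewrite [y \in U]memvE => xy /subvP; apply. Qed.

Lemma dim_gt0_nonzero U : (0 < \dim U)%N -> exists2 x, x != 0 & x \in U.
Proof.
by rewrite lt0n dimv_eq0 => nU; exists (vpick U); rewrite ?vpick0 ?memv_pick.
Qed.

Lemma dim_line_add x U :
  \dim (<[x]> + U)%VS = ((x \notin U) + \dim U)%N.
Proof.
case: (boolP (x \in U)) => xU /=.
  by congr (\dim _); apply/addv_idPr; rewrite -memvE.
have nx : x != 0 by apply: contraNneq xU => ->; rewrite mem0v.
rewrite dimv_disjoint_sum ?dim_vline ?nx //.
apply/eqP; rewrite -subv0; apply/subvP=> y; rewrite memv_cap memv0.
case/andP=> /vlineP[c ->] cU; rewrite scaler_eq0 (negPf nx) orbF.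
by apply: contraNT xU => nc; rewrite -(scalerK nc x) memvZ.
Qed.

(* Projectively: pairwise meeting lines that are not all coplanar concur. *)
Lemma common_line_of_planes (I : eqType) (A : pred I) (P : I -> {vspace vT}) :
    (forall i, A i -> \dim (P i) = 2%N) ->
    (forall i j, A i -> A j -> i != j -> \dim (P i + P j)%VS = 3%N) ->
    (exists i j k, [/\ A i, A j, A k, i != j & ~~ (P k <= P i + P j)%VS]) ->
  exists2 v, v != 0 & forall i, A i -> v \in P i.
Proof.
move=> dP dPP [i [j [k [Ai Aj Ak ij kW]]]].
have dcap s t : A s -> A t -> s != t -> \dim (P s :&: P t)%VS = 1%N.
  move=> As At st; have := dimv_sum_cap (P s) (P t).
  by rewrite dPP // !dP // => -[].
have meet s t : A s -> A t -> s != t ->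
    exists x, [/\ x != 0, x \in P s & x \in P t].
  move=> As At st; have [|x nx] := @dim_gt0_nonzero (P s :&: P t)%VS.
    by rewrite dcap.
  by rewrite memv_cap => /andP[xs xt]; exists x.
set W := (P i + P j)%VS in kW.
have iW : (P i <= W)%VS by apply: addvSl.
have jW : (P j <= W)%VS by apply: addvSr.
have ki : k != i by apply: contraNneq kW => ->.
have kj : k != j by apply: contraNneq kW => ->.
have dkW : (\dim (P k :&: W) <= 1)%N.
  rewrite -ltnS -(dP k Ak) ltn_neqAle dimvS ?capvSl // andbT.
  apply: contra kW => /eqP e.
  by apply/capv_idPl/eqP; rewrite eqEdim capvSl e leqnn.
(* [P k] meets [P i] in [v] and [P j] in [b]. Both vectors lie in [P k :&: W], of dimension at most
   1, so they are proportional and [v] lies in all three planes. *)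
have [v [nv vk vi]] := meet k i Ak Ai ki.
have [b [nb bk bj]] := meet k j Ak Aj kj.
have vkW : v \in (P k :&: W)%VS by rewrite memv_cap vk (subvP iW).
have bkW : b \in (P k :&: W)%VS by rewrite memv_cap bk (subvP jW).
have vj : v \in P j by apply: memv_line_trans bj; apply: memv_line_dim1 vkW.
exists v => // s As; apply/negPn/negP => vs.
have neq t : v \in P t -> s != t by move=> vt; apply: contraNneq vs => ->.
have [x [nx xs xi]] := meet s i As Ai (neq i vi).
have [y [ny ys yj]] := meet s j As Aj (neq j vj).
have [z [nz zs zk]] := meet s k As Ak (neq k vk).
(* If proportional, [x] and [y] would span the line [P i :&: P j], which contains [v], forcing [v]
   into [P s]. Being independent, they span [P s], which thus lies in [W]. *)
have xNy : x \notin <[y]>%VS.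
  apply: contra vs => xy; apply: memv_line_trans xs.
  apply: (@memv_line_dim1 (P i :&: P j)%VS) => //; rewrite ?dcap ?memv_cap ?vi //.
  by rewrite xi (memv_line_trans xy).
have sW : (P s <= W)%VS.
  suff <- : (<[x]> + <[y]>)%VS = P s.
    by rewrite subv_add -!memvE (subvP iW) ?(subvP jW).
  apply/eqP; rewrite eqEdim subv_add -!memvE xs ys.
  by rewrite dim_line_add xNy dim_vline ny dP.
(* Now [z] lies in [P k :&: W] along with [v], so [v] is a multiple of [z], hence in [P s]. *)
case/negP: vs; apply: memv_line_trans (zs); apply: memv_line_dim1 vkW => //.
by rewrite memv_cap zk (subvP sW).
Qed.

End CommonLine.

(** * Lines, skewness and affine hulls in terms of vector subspaces *)

Section Flats.
Set Implicit Arguments.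
Unset Strict Implicit.
Variables (R : realType) (l : nat).
Implicit Types (p q d e O : 'rV[R]_l) (V : {vspace 'rV[R]_l}).

Lemma flat_refl p V : flat p V p.
Proof. by rewrite /flat /= subrr mem0v. Qed.

Lemma flat_base p q V : flat p V q -> flat p V = flat q V.
Proof.
rewrite /flat /= => qp; apply/seteqP; split=> x /= xV.
  by rewrite -(subrKA p) -[p - q]opprB rpredB.
by rewrite -(subrKA q) rpredD.
Qed.

Lemma line_vector (A : set 'rV[R]_l) :
  is_line A -> exists p d, d != 0 /\ A = flat p <[d]>%VS.
Proof.
case=> p [V [dV ->]]; have [|d nd dinV] := @dim_gt0_nonzero _ _ V.
  by rewrite dV.
exists p, d; split=> //; congr flat; apply/eqP.
by rewrite eq_sym eqEdim -memvE dinV dim_vline nd dV.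
Qed.

(** The direction space of the least flat containing [O] and the line: a plane if the line avoids
    [O], the direction of the line otherwise. *)
Definition cone O p d : {vspace 'rV[R]_l} := (<[p - O]> + <[d]>)%VS.

Lemma line_sub_flat O p d V :
  flat p <[d]>%VS `<=` flat O V <-> (cone O p d <= V)%VS.
Proof.
rewrite /cone subv_add -!memvE; split=> [sub|/andP[pV dV] x /vlineP[c e]].
  have pV : p - O \in V := sub p (flat_refl _ _).
  have : flat O V (p + d).
    by apply: sub; rewrite /flat /= addrAC subrr add0r memv_line.
  rewrite /flat /= addrAC pV => h /=.
  by rewrite -(addKr (p - O) d) addrC rpredB.
by rewrite /flat /= -(subrKA p) e rpredD // memvZ.
Qed.

Lemma mem_cone O p d : flat p <[d]>%VS O -> cone O p d = <[d]>%VS.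
Proof.
move=> Od; apply/addv_idPr; rewrite -memvE -opprB memvN; exact: Od.
Qed.

Lemma dim_cone O p d : d != 0 -> ~ flat p <[d]>%VS O -> \dim (cone O p d) = 2%N.
Proof.
move=> nd Od; rewrite /cone dim_line_add dim_vline nd.
by rewrite -opprB memvN; case: (boolP (_ \in _)) => // /Od.
Qed.

(** Every flat containing both lines contains [O], so it can be rebased there, and containing a line
    then means containing its cone. *)
Lemma affine_hull_lines O p d q e :
  affine_hull (flat p <[d]>%VS `|` flat q <[e]>%VS) O ->
  affine_hull (flat p <[d]>%VS `|` flat q <[e]>%VS) =
    flat O (cone O p d + cone O q e)%VS.
Proof.
move=> OH; apply/seteqP; split=> x.
  apply; split; first by exists O, (cone O p d + cone O q e)%VS.
  by rewrite subUset; split; apply/line_sub_flat; rewrite ?addvSl ?addvSr.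
move=> xF _ [[a [V ->]]] sub; have OV : flat a V O.
  by apply: OH; split=> //; exists a, V.
move: sub; rewrite (flat_base OV) subUset => -[/line_sub_flat s1 /line_sub_flat s2].
by apply: (subvP _ _ xF); rewrite subv_add s1.
Qed.

(** Dependent directions would make the lines parallel; [q - p = u + w] with [u], [w] along the two
    lines would give the common point [p + u = q - w]. *)
Lemma dim_skew p d q e : d != 0 -> e != 0 ->
  skew (flat p <[d]>%VS) (flat q <[e]>%VS) ->
  \dim (<[q - p]> + (<[d]> + <[e]>))%VS = 3%N.
Proof.
move=> nd ne [meet par]; rewrite !dim_line_add dim_vline ne.
have -> /= : d \notin <[e]>%VS.
  apply/negP=> de; apply: par; exists p, q, <[e]>%VS; split=> //.
  by congr flat; apply/eqP; rewrite eqEdim -memvE de !dim_vline nd ne.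
suff -> : q - p \notin (<[d]> + <[e]>)%VS by [].
apply/negP=> /memv_addP[u ud [w we E]]; apply: meet; exists (p + u).
split; rewrite /flat /=; first by rewrite addrAC subrr add0r.
suff -> : p + u - q = - w by rewrite memvN.
by rewrite -(addKr u w) -E opprD opprK opprB addrCA addrA.
Qed.

(** The sum of cones and the span in [dim_skew] are the direction space of the same hull, based at
    [O] and at [p]. *)
Lemma dim_cones O p d q e : d != 0 -> e != 0 ->
  skew (flat p <[d]>%VS) (flat q <[e]>%VS) ->
  affine_hull (flat p <[d]>%VS `|` flat q <[e]>%VS) O ->
  \dim (cone O p d + cone O q e)%VS = 3%N.
Proof.
move=> nd ne sk OH; rewrite -(dim_skew nd ne sk); congr (\dim _).
set V := (<[q - p]> + _)%VS.
have qpV : q - p \in V by rewrite memvE addvSl.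
have dV : d \in V by rewrite memvE /V addvA (subv_trans _ (addvSl _ _)) ?addvSr.
have eV : e \in V by rewrite memvE /V addvA addvSr.
have [sp sq] : flat p <[d]>%VS `<=` flat p V /\ flat q <[e]>%VS `<=` flat p V.
  by split; apply/line_sub_flat; rewrite subv_add -!memvE ?subrr ?mem0v ?qpV.
have OV : flat p V O.
  by apply: OH; split; [exists p, V | rewrite subUset].
move: sp sq; rewrite (flat_base OV) => /line_sub_flat sp /line_sub_flat sq.
apply/eqP; rewrite eqEsubv subv_add sp sq /= !subv_add -!memvE.
have [pC dC] : p - O \in (cone O p d + cone O q e)%VS /\
               d \in (cone O p d + cone O q e)%VS.
  by split; apply: subvP (addvSl _ _) _ _; rewrite memvE ?addvSl ?addvSr.
have [qC eC] : q - O \in (cone O p d + cone O q e)%VS /\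
               e \in (cone O p d + cone O q e)%VS.
  by split; apply: subvP (addvSr _ _) _ _; rewrite memvE ?addvSl ?addvSr.
by rewrite dC eC -(subrKA O) -[O - p]opprB rpredB.
Qed.

End Flats.

Theorem mainTheorem7 (R : realType) (l n m : nat)
    (L : 'I_n -> set 'rV[R]_l) (H : 'I_m -> set 'rV[R]_l) (O : 'rV[R]_l) :
  (4 <= l)%N ->
  (forall i, is_line (L i)) ->
  (forall i j, i != j -> skew (L i) (L j)) ->
  (forall i j, i != j ->
     exists k, [/\ k != i, k != j & L k `<=` affine_hull (L i `|` L j)]) ->
  injective H ->
  range H = pair_hulls L ->
  (2 <= m)%N ->
  O \in \bigcap_i H i ->
  exists M : set 'rV[R]_l,
    [/\ is_line M, O \in M, forall i, M <> L i & forall i, coplanar (L i) M].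
Proof.
move=> _ lineL skewL thirdL injH rangeH m2; rewrite in_setE => OH.
have /choice[p /choice[d pd]] := fun i => line_vector (lineL i).
have nd i : d i != 0 by case: (pd i).
have LE i : L i = flat (p i) <[d i]>%VS by case: (pd i).
pose P i := cone O (p i) (d i).
have OL i j : i != j -> affine_hull (L i `|` L j) O.
  move=> ij; have : pair_hulls L (affine_hull (L i `|` L j)) by exists i, j.
  by rewrite -rangeH => -[t _ <-]; apply: OH.
have hullE i j : i != j -> affine_hull (L i `|` L j) = flat O (P i + P j)%VS.
  by move=> /OL; rewrite !LE; apply: affine_hull_lines.
have dPP i j : i != j -> \dim (P i + P j)%VS = 3%N.
  move=> ij; have := OL _ _ ij; have := skewL _ _ ij; rewrite !LE.
  exact: dim_cones.
have LP i V : L i `<=` flat O V <-> (P i <= V)%VS.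
  by rewrite LE; apply: line_sub_flat.
have third i j : i != j -> exists k, [/\ k != i, k != j & (P k <= P i + P j)%VS].
  move=> ij; have [k [ki kj]] := thirdL _ _ ij.
  by rewrite hullE // => /LP kP; exists k.
pose A := [pred i | O \notin L i].
have dPA i : A i -> \dim (P i) = 2%N.
  rewrite /= LE => Oi; apply: dim_cone => // Oi'.
  by case/negP: Oi; rewrite in_setE.
have dPN i : ~~ A i -> \dim (P i) = 1%N.
  by rewrite /= negbK LE in_setE => /mem_cone e; rewrite /P e dim_vline nd.
(* Two lines through [O] would have cones with a sum of dimension at most 2, not 3. *)
have NA i j : ~~ A i -> i != j -> A j.
  move=> Ai ij; apply: contraT => Aj.
  by have := (dimv_add_leqif (P i) (P j)).1; rewrite dPP // !dPN.
(* Every hull is spanned by two lines avoiding [O]: a member through [O] is replaced by the third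
   line [k] of that hull. *)
have spanA i j : i != j -> exists s t,
    [/\ A s, A t, s != t & (P i + P j = P s + P t)%VS].
  have aux s t : ~~ A s -> s != t -> exists s' t',
      [/\ A s', A t', s' != t' & (P s + P t = P s' + P t')%VS].
    move=> As st; have [k [ks kt kP]] := third _ _ st.
    exists k, t; split=> //; try by apply: NA As _; rewrite // eq_sym.
    apply/eqP; rewrite eq_sym.
    by rewrite eqEdim subv_add kP addvSr !dPP.
  move=> ij; case: (boolP (A i)) => Ai; last exact: aux.
  case: (boolP (A j)) => Aj; first by exists i, j.
  by rewrite addvC; apply: aux => //; rewrite eq_sym.
have notflat : exists i j k, [/\ A i, A j, A k, i != j & ~~ (P k <= P i + P j)%VS].
  apply: contrapT => nex.
  have all_sub i j k : A i -> A j -> A k -> i != j -> (P k <= P i + P j)%VS.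
    move=> Ai Aj Ak ij; apply: contraT => kW; case: nex.
    by exists i, j, k.
  have hullH (a : 'I_m) : exists s t,
      [/\ A s, A t, s != t & H a = flat O (P s + P t)%VS].
    have [i [j [ij ->]]] : pair_hulls L (H a) by rewrite -rangeH; exists a.
    by have [s [t [As At st e]]] := spanA _ _ ij; exists s, t; rewrite hullE ?e.
  (* These are the indices 0 and 1; with all cones inside each sum, [H] would agree on them. *)
  have : Ordinal (ltnW m2) = Ordinal m2.
    apply: injH; have [s [t [As At st ->]]] := hullH (Ordinal (ltnW m2)).
    have [s' [t' [As' At' st' ->]]] := hullH (Ordinal m2); congr flat.
    by apply/eqP; rewrite eqEsubv; apply/andP; split; rewrite subv_add !all_sub.
  by move/(congr1 val).
have [v nv vP] := common_line_of_planes dPA (fun i j _ _ => @dPP i j) notflat.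
have [i0 Ai0] : exists i, A i by case: notflat => i [? [? []]]; exists i.
(* Here [P i] has dimension 1 and [P i0] dimension 2, with sum of dimension 3, so they meet only in
   0, while [v] is in [P i0]. *)
have vN i : ~~ A i -> v \notin P i.
  move=> Ai; have ii0 : i != i0 by apply: contraNneq Ai => ->.
  apply/negP => vi; have := dimv_sum_cap (P i) (P i0).
  rewrite dPP // dPN // dPA // => -[/eqP].
  by rewrite dimv_eq0 => /eqP cap0; case/negP: nv; rewrite -memv0 -cap0 memv_cap vi vP.
exists (flat O <[v]>%VS); split.
- by exists O, <[v]>%VS; rewrite dim_vline nv.
- by rewrite in_setE; apply: flat_refl.
- move=> i E; have [Ai|Ai] := boolP (A i).
    by case/negP: Ai; rewrite -E in_setE; apply: flat_refl.
  case/negP: (vN i Ai); suff -> : P i = <[v]>%VS by apply: memv_line.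
  apply/eqP; rewrite eqEdim dim_vline nv dPN // andbT.
  by apply/LP; rewrite E.
(* The common plane is [P i] through [O] if [L i] avoids [O]; otherwise two distinct lines through
   [O] span it. *)
move=> i; have [Ai|Ai] := boolP (A i).
  exists (flat O (P i)); split; first by exists O, (P i); rewrite dPA.
    exact/LP.
  by move=> x; apply: subvP; rewrite -memvE vP.
exists (flat O (<[v]> + P i)%VS); split.
- by exists O, (<[v]> + P i)%VS; rewrite dim_line_add vN ?dPN.
- by apply/LP; rewrite addvSr.
- by move=> x; apply: subvP; rewrite addvSl.
Qed.
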